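(* Let $G$ be a finite graph (all of whose components are plain). For every $k\ge 1$ and all integers $n_1,\dots,n_k$ (positive, negative or zero), $$M\bigl((G\times P_{n_1})(G\times P_{n_2})\cdots(G\times P_{n_k})\bigr)=M\bigl(G\times P_{n_1+n_2+\cdots+n_k}\bigr),$$ where juxtaposition denotes adjunction of signed graphs. In particular, writing $G(m,n)=P_m\times P_n$, for every $m\ge 1$ and all integers $n_1,\dots,n_k$, $$M\bigl(G(m,n_1)G(m,n_2)\cdots G(m,n_k)\bigr)=M\bigl(G(m,n_1+n_2+\cdots+n_k)\bigr).$$
   Context: Signed graphs. A signed graph is a finite graph in which each vertex is of one of three kinds: plain (weight $1$), anti-vertex (weight $-1$), or empty vertex (weight $0$); and each edge is of one of three kinds: plain vertical edge or ''vedge'' (weight $1$), anti-vedge (weight $-1$), or horizontal edge or ''hedge'' (weight $1$). A signed matching of a signed graph is a set of pairwise non-adjacent edges together with all the vertices not incident with any of those edges; its weight is the product of the weights of all the edges and vertices it contains (empty product $=1$). So a signed matching of nonzero weight must cover every empty vertex by an edge. $M(\Gamma)$ denotes the sum of the weights of all signed matchings of the signed graph $\Gamma$. Conjugation. $\Gamma^*$ is obtained from $\Gamma$ by interchanging plain vertices with anti-vertices and vedges with anti-vedges, leaving hedges alone. Generalized rectangles. Let $G$ be a finite graph, its vertices regarded as plain vertices and its edges as plain vedges. For $n>0$, $G\times P_n$ consists of $n$ copies of $G$ lined up side by side from left to right, every vertex of a copy being joined by a hedge to its image in each neighbouring copy. The same construction applied to $G^*$ gives $G^*\times P_n$. For $n>0$,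 $G\times P_{-n}$ is $G^*\times P_n$ together with, for each vertex $v$ of $G$, one empty vertex on the left joined by a hedge to the image of $v$ in the leftmost copy of $G^*$, and one empty vertex on the right joined by a hedge to the image of $v$ in the rightmost copy of $G^*$ (and to nothing else). $G\times P_0$ consists, for each vertex $v$ of $G$, of two empty vertices (left and right) joined to each other by a hedge. $P_m$ is the path graph with $m$ vertices, so $G(m,n)$ is the $m$ by $n$ grid graph when $n>0$. Adjunction. For a vertex $v$ of $G$, the left (right) boundary vertex of $G\times P_n$ corresponding to $v$ is the image of $v$ in the leftmost (rightmost) copy of $G$ if $n>0$, and the left (right) empty vertex corresponding to $v$ if $n\le 0$. The adjunction $(G\times P_{n_1})(G\times P_{n_2})$ is the disjoint union of the two signed graphs with, for each vertex $v$ of $G$, an added hedge joining the right boundary vertex of $G\times P_{n_1}$ corresponding to $v$ to the left boundary vertex of $G\times P_{n_2}$ corresponding to $v$. The $k$-fold adjunction $(G\times P_{n_1})\cdots(G\times P_{n_k})$ is obtained by adjoining consecutive factors in this way. *)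

(* Defs.v *)
From mathcomp Require Import all_boot all_order all_algebra.

Set Implicit Arguments.
Unset Strict Implicit.
Unset Printing Implicit Defensive.

Import GRing.Theory.
Local Open Scope ring_scope.

(* Finite loopless graphs; parallel edges are allowed, so every finite simple
   graph is an instance.  The order of the two endpoints of an edge carries no
   meaning: [ends] is only used through [incident]. *)
Record graph := Graph {
  vertex :> finType;
  edge : finType;
  ends : edge -> vertex * vertex;
  loopless : forall e, (ends e).1 != (ends e).2 }.

Definition incident (G : graph) (e : edge G) (v : G) : bool :=
  (v == (ends e).1) || (v == (ends e).2).

Definition adjacent (G : graph) (e f : edge G) : bool :=
  (e != f) && [exists v, incident e v && incident f v].

Lemma path_loopless m (e : {p : 'I_m * 'I_m | p.1.+1 == p.2 :> nat}) :
  (val e).1 != (val e).2.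
Proof.
by case: e => [[i j]] /= /eqP ij; rewrite -val_eqE /= -ij neq_ltn ltnSn.
Qed.

Definition path_graph (m : nat) : graph := Graph (@path_loopless m).

Inductive vertex_kind := PlainVertex | AntiVertex | EmptyVertex.
Inductive edge_kind := Vedge | AntiVedge | Hedge.

Record sgraph := SGraph {
  sgraph_graph :> graph;
  vkind : vertex sgraph_graph -> vertex_kind;
  ekind : edge sgraph_graph -> edge_kind }.

Definition vertex_weight (k : vertex_kind) : int :=
  match k with PlainVertex => 1 | AntiVertex => -1 | EmptyVertex => 0 end.

Definition edge_weight (k : edge_kind) : int :=
  match k with Vedge => 1 | AntiVedge => -1 | Hedge => 1 end.

(* A signed matching is determined by its set [S] of edges, its vertices being
   exactly those that no edge of [S] covers. *)
Definition matching (G : sgraph) (S : {set edge G}) : bool :=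
  [forall e in S, forall f in S, ~~ adjacent e f].

Definition uncovered (G : sgraph) (S : {set edge G}) : {set G} :=
  [set v | [forall e in S, ~~ incident e v]].

Definition weight (G : sgraph) (S : {set edge G}) : int :=
  (\prod_(e in S) edge_weight (ekind e)) *
  (\prod_(v in uncovered S) vertex_weight (vkind v)).

Definition M (G : sgraph) : int := \sum_(S : {set edge G} | matching S) weight S.

Definition plain (G : graph) : sgraph :=
  @SGraph G (fun=> PlainVertex) (fun=> Vedge).

Definition conj_vertex (k : vertex_kind) : vertex_kind :=
  match k with
  | PlainVertex => AntiVertex | AntiVertex => PlainVertex
  | EmptyVertex => EmptyVertex
  end.

Definition conj_edge (k : edge_kind) : edge_kind :=
  match k with Vedge => AntiVedge | AntiVedge => Vedge | Hedge => Hedge end.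

Definition conjugate (G : sgraph) : sgraph :=
  @SGraph G (fun v => conj_vertex (vkind v)) (fun e => conj_edge (ekind e)).

(* A signed graph with left and right boundary vertices indexed by [V]. *)
Record strip (V : finType) := Strip {
  strip_sgraph :> sgraph;
  lbound : V -> strip_sgraph;
  rbound : V -> strip_sgraph }.

Section Copies.
Variables (H : sgraph) (n : nat).

Definition copies_ends (e : 'I_n * edge H + edge (path_graph n) * H) :
    ('I_n * H) * ('I_n * H) :=
  match e with
  | inl (i, a) => ((i, (ends a).1), (i, (ends a).2))
  | inr (s, v) => (((ends s).1, v), ((ends s).2, v))
  end.

Lemma copies_loopless e : (copies_ends e).1 != (copies_ends e).2.
Proof.
case: e => [[i a]|[s v]] /=.
- by rewrite xpair_eqE eqxx; exact: loopless.
- by rewrite xpair_eqE eqxx andbT; exact: (@path_loopless n s).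
Qed.

Definition copies : sgraph :=
  @SGraph (Graph copies_loopless) (fun p => vkind p.2)
    (fun e => match e with inl (_, a) => ekind a | inr _ => Hedge end).

End Copies.

Definition pos_strip (H : sgraph) (n : nat) : strip H :=
  @Strip H (copies H n.+1) (fun v => (ord0, v)) (fun v => (ord_max, v)).

Section Cap.
Variables (V : finType) (A : strip V).

(* The vertex [inr (false, v)] is the left empty vertex of [v] and
   [inr (true, v)] the right one. *)
Definition cap_ends (e : edge A + bool * V) :
    (A + bool * V) * (A + bool * V) :=
  match e with
  | inl a => (inl (ends a).1, inl (ends a).2)
  | inr (b, v) => (inr (b, v), inl (if b then rbound A v else lbound A v))
  end.

Lemma cap_loopless e : (cap_ends e).1 != (cap_ends e).2.
Proof. by case: e => [a|[b v]] //=; apply: loopless. Qed.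

Definition cap : strip V :=
  @Strip V
    (@SGraph (Graph cap_loopless)
       (fun x => match x with inl v => vkind v | inr _ => EmptyVertex end)
       (fun e => match e with inl a => ekind a | inr _ => Hedge end))
    (fun v => inr (false, v)) (fun v => inr (true, v)).

End Cap.

Section Zero.
Variable V : finType.

Definition zero_ends (v : V) : (bool * V) * (bool * V) := ((false, v), (true, v)).

Lemma zero_loopless v : (zero_ends v).1 != (zero_ends v).2.
Proof. by []. Qed.

Definition zero_strip : strip V :=
  @Strip V
    (@SGraph (Graph zero_loopless) (fun=> EmptyVertex) (fun=> Hedge))
    (fun v => (false, v)) (fun v => (true, v)).

End Zero.

(* G x P_n for an arbitrary integer n; [Negz n] is -(n+1). *)
Definition times_path (G : graph) (n : int) : strip G :=
  match n with
  | Posz 0 => zero_strip G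
  | Posz n'.+1 => pos_strip (plain G) n'
  | Negz n' => cap (pos_strip (conjugate (plain G)) n')
  end.

Definition grid (m : nat) (n : int) : strip (path_graph m) :=
  times_path (path_graph m) n.

Section Adjunction.
Variables (V : finType) (A B : strip V).

Definition adjoin_ends (e : edge A + edge B + V) : (A + B) * (A + B) :=
  match e with
  | inl (inl a) => (inl (ends a).1, inl (ends a).2)
  | inl (inr b) => (inr (ends b).1, inr (ends b).2)
  | inr v => (inl (rbound A v), inr (lbound B v))
  end.

Lemma adjoin_loopless e : (adjoin_ends e).1 != (adjoin_ends e).2.
Proof. by case: e => [[a|b]|v] //=; apply: loopless. Qed.

Definition adjoin : strip V :=
  @Strip V
    (@SGraph (Graph adjoin_loopless)
       (fun x => match x with inl v => vkind v | inr v => vkind v end)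
       (fun e => match e with
                 | inl (inl a) => ekind a
                 | inl (inr b) => ekind b
                 | inr _ => Hedge
                 end))
    (fun v => inl (lbound A v)) (fun v => inr (rbound B v)).

End Adjunction.

(* The adjunction A B_1 ... B_k, bracketed to the left. *)
Definition adjoin_seq (V : finType) (A : strip V) (Bs : seq (strip V)) : strip V :=
  foldl (@adjoin V) A Bs.

(* Main.v *)
Require Import Defs.
From mathcomp Require Import all_boot all_order all_algebra.

(** The proof is the transfer matrix method.  A strip [A] with boundary [V] gets
    a matrix [T_A] indexed by pairs of subsets of [V]: the entry at [(X, Y)] is
    the signed count of the matchings of [A] in which the left boundary vertices
    of [X] and the right boundary vertices of [Y] are already covered from the
    outside.  Then [M A] is the entry at [(set0, set0)] ([M_transfer]), and
    cutting an adjunction along the set [Z] of added hedges that belong to the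
    matching gives [T_(A B) = T_A T_B] ([transfer_adjoin]).

    Let [T] be the matrix of one plain column [G] and [T'] that of one conjugate
    column.  A block of [n] columns is an iterated adjunction of single columns,
    so [G x P_n] has matrix [T ^ n] for [n > 0] ([transfer_matrix_pos]).  The
    strip [G x P_0] has the identity matrix, because each of its hedges is used
    exactly when neither of its ends is covered from the outside
    ([transfer_zero]).  Capping with empty vertices replaces both index sets by
    their complements ([transfer_cap]), because the hedge at an empty vertex is
    used exactly when that vertex is not covered from the outside; hence
    [G x P_(-n)] has matrix [(J T' J) ^ n], where [J] is the permutation matrix
    of complementation.

    The heart of the matter is [T * (J T' J) = 1] ([transfer_plain_conjugate]):
    in the sum over the intermediate sets, each edge or vertex of a matching can
    belong either to the plain column or to the conjugate one, with opposite
    signs, so that everything cancels except the empty configuration.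

    Consequently [G x P_n] has matrix [T ^ n] for every integer [n]
    ([transfer_matrix_times_path]), and the theorem is the law
    [T ^ (m + n) = T ^ m * T ^ n] for an invertible matrix. *)

Set Implicit Arguments.
Unset Strict Implicit.
Unset Printing Implicit Defensive.

Import GRing.Theory.
Local Open Scope ring_scope.

(** * The transfer function of a strip *)

Definition degree (G : graph) (S : {set edge G}) (v : G) : nat :=
  \sum_(e in S) incident e v.

Definition hits {V W : finType} (f : V -> W) (X : {set V}) (w : W) : nat :=
  \sum_(v in X) (w == f v).

(** The contribution of a vertex of kind [k] that is covered [d] times.  Its
    vanishing for [d > 1] enforces the matching condition, so that sums can
    range over all edge sets and every vertex contributes independently. *)
Definition vfactor (k : vertex_kind) (d : nat) : int :=
  match d with 0 => vertex_weight k | 1 => 1 | _ => 0 end.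

Definition eweight (G : sgraph) (S : {set edge G}) : int :=
  \prod_(e in S) edge_weight (ekind e).

(** External hedges at the boundary vertices of [X] and [Y] enter only through
    the number of times that they cover a vertex.  In a strip with a single
    column the two boundaries coincide, and this count then excludes covering a
    vertex from both sides. *)
Definition transfer {V : finType} (A : strip V) (X Y : {set V}) : int :=
  \sum_(S : {set edge A}) eweight S * \prod_(v : A)
    vfactor (vkind v) (degree S v + hits (lbound A) X v + hits (rbound A) Y v).

Lemma hits0 (V W : finType) (f : V -> W) w : hits f set0 w = 0%N.
Proof. by rewrite /hits big_set0. Qed.

Lemma hits_inj (V W : finType) (f : V -> W) X v :
  injective f -> hits f X (f v) = (v \in X).
Proof.
move=> fI; rewrite /hits; under eq_bigr => i _ do rewrite (inj_eq fI).
case: (boolP (v \in X)) => vX.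
  rewrite (bigD1 v) //= eqxx big1 // => i /andP[_ iv].
  by rewrite eq_sym (negPf iv).
by rewrite big1 // => i iX; case: eqP => // vi; rewrite vi iX in vX.
Qed.

Lemma degree_le1 (G : sgraph) (S : {set edge G}) (v : G) :
  matching S -> (degree S v <= 1)%N.
Proof.
move=> /forall_inP mS; rewrite /degree.
case: (pickP (fun e => (e \in S) && incident e v)) => [e /andP[eS ev]|none].
  rewrite (bigD1 e) //= ev big1 // => f /andP[fS fe].
  have /forall_inP/(_ f fS) := mS e eS.
  rewrite /adjacent eq_sym fe /= => /existsPn/(_ v).
  by rewrite ev /= => /negPf->.
by rewrite big1 // => e eS; have := none e; rewrite eS /= => ->.
Qed.

Lemma degree_gt1 (G : sgraph) (S : {set edge G}) :
  ~~ matching S -> exists v : G, (1 < degree S v)%N.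
Proof.
case/forall_inPn=> e eS /forall_inPn[f fS] /negPn/andP[ef].
case/existsP=> v /andP[ev fv].
exists v; rewrite /degree (bigD1 e) //= (bigD1 f) ?fS 1?eq_sym //= ev fv.
by rewrite addnA leq_addr.
Qed.

Lemma degree_eq0 (G : sgraph) (S : {set edge G}) (v : G) :
  (degree S v == 0%N) = (v \in uncovered S).
Proof.
rewrite /degree sum_nat_eq0 inE.
by apply: eq_forallb => e; rewrite eqb0.
Qed.

Lemma M_transfer (V : finType) (A : strip V) : M A = transfer A set0 set0.
Proof.
rewrite /M /transfer big_mkcond; apply: eq_bigr => S _.
under [in RHS]eq_bigr => v _ do rewrite !hits0 !addn0.
case: ifPn => [mS|/degree_gt1[v dv]].
  rewrite /weight; congr (_ * _); rewrite big_mkcond; apply: eq_bigr => v _.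
  have := degree_le1 v mS; rewrite -degree_eq0.
  by case: (degree S v) => [|[|]].
rewrite (bigD1 v) //=; case: (degree S v) dv => [|[|d]] //= _.
by rewrite mul0r mulr0.
Qed.

(** * Adjunction multiplies transfer functions *)

Definition sum_set {I J : finType} (A : {set I}) (B : {set J}) : {set I + J} :=
  [set x | match x with inl i => i \in A | inr j => j \in B end].

Lemma big_sum_set (R : Type) (idx : R) (op : Monoid.law idx) (I J : finType)
    (A : {set I}) (B : {set J}) (F : I + J -> R) :
  \big[op/idx]_(x in sum_set A B) F x =
  op (\big[op/idx]_(i in A) F (inl i)) (\big[op/idx]_(j in B) F (inr j)).
Proof.
rewrite big_sumType; congr (op _ _); apply: eq_bigl => x; by rewrite inE.
Qed.

Lemma sum_over_sum_set (I J : finType) (F : {set I + J} -> int) :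
  \sum_S F S = \sum_A \sum_B F (sum_set A B).
Proof.
rewrite pair_bigA /= (reindex (fun p : {set I} * {set J} => sum_set p.1 p.2)) //=.
exists (fun S : {set I + J} => ([set i | inl i \in S], [set j | inr j \in S])).
  by move=> [A B] _ /=; congr (_, _); apply/setP => x; rewrite !inE.
by move=> S _; apply/setP => -[x|x]; rewrite !inE.
Qed.

(** [Z] is the set of added hedges used: it covers the right boundary of [A] and
    the left boundary of [B]. *)
Lemma transfer_adjoin (V : finType) (A B : strip V) X Y :
  transfer (adjoin A B) X Y = \sum_Z transfer A X Z * transfer B Z Y.
Proof.
rewrite /transfer /= sum_over_sum_set exchange_big; apply: eq_bigr => Z _ /=.
rewrite sum_over_sum_set.
rewrite mulr_suml; apply: eq_bigr => SA _.
rewrite mulr_sumr; apply: eq_bigr => SB _.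
rewrite /eweight big_sum_set big_sum_set /= [X in _ * X * _]big1 // mulr1.
rewrite big_sumType /= mulrACA; congr (_ * _ * (_ * _)).
  apply: eq_bigr => v _; congr vfactor.
  rewrite /degree /hits !big_sum_set /= /incident /=.
  rewrite [X in (_ + X + _ + _ + _)%N]big1 // [X in (_ + _ + _ + _ + X)%N]big1 //.
  rewrite !addn0 addnAC; congr (_ + _ + _)%N.
  by apply: eq_bigr => i _; rewrite orbF.
apply: eq_bigr => v _; congr vfactor.
rewrite /degree /hits !big_sum_set /= /incident /=.
by rewrite big1 // add0n [X in (_ + _ + X + _)%N]big1 // addn0.
Qed.

(** * Empty vertices: the zero strip and caps *)

Lemma vfactor_empty d : vfactor EmptyVertex d = (d == 1%N)%:R.
Proof. by case: d => [|[|]]. Qed.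

Lemma prod_bool (I : finType) (P : pred I) :
  \prod_i (P i)%:R = [forall i, P i]%:R :> int.
Proof.
case: forallP => [H|/forallP/forallPn[i /negPf Pi]].
  by rewrite big1 // => i _; rewrite H.
by rewrite (bigD1 i) //= Pi mul0r.
Qed.

Lemma sum_only (I : finType) (i0 : I) (F : I -> int) :
  (forall i, i != i0 -> F i = 0) -> \sum_i F i = F i0.
Proof. by move=> H; rewrite (bigD1 i0) //= big1 ?addr0. Qed.

(** A set [S] of hedges covers every empty vertex exactly once precisely when
    both [X] and [Y] are the complement of [S]. *)
Lemma transfer_zero (V : finType) (X Y : {set V}) :
  transfer (zero_strip V) X Y = (X == Y)%:R.
Proof.
have deg S (v : bool * V) : degree (G := zero_strip V) S v = (v.2 \in S).
  case: v => b v; rewrite /= -(@hits_inj _ _ (fun x => x) S) // /degree /hits.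
  apply: eq_bigr => w _; rewrite /incident /zero_ends /= !xpair_eqE.
  by case: b; rewrite /= ?orbF.
have hit b Z (v : bool * V) :
    hits (W := (bool * V)%type) (fun v => (b, v)) Z v =
    (v.1 == b) && (v.2 \in Z) :> nat.
  case: v => b' v; rewrite /hits; under eq_bigr => w _ do rewrite xpair_eqE.
  case: eqP => [_|_]; last by rewrite big1.
  by rewrite -(@hits_inj _ _ (fun x => x) Z).
have tE S : \prod_(v : bool * V) vfactor EmptyVertex
     (degree (G := zero_strip V) S v + hits (lbound (zero_strip V)) X v
        + hits (rbound (zero_strip V)) Y v)
   = ((X == ~: S) && (Y == ~: S))%:R :> int.
  under eq_bigr => v _ do rewrite vfactor_empty.
  rewrite prod_bool; congr (_%:R); congr nat_of_bool; apply/forallP/andP.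
    move=> H; split; apply/eqP/setP => v.
      have := H (false, v); rewrite deg /= !hit /= !inE addn0.
      by case: (v \in S); case: (v \in X).
    have := H (true, v); rewrite deg /= !hit /= !inE addn0.
    by case: (v \in S); case: (v \in Y).
  move=> [/eqP-> /eqP->] [b v]; rewrite deg !hit /= !inE.
  by case: b; case: (v \in S).
rewrite /transfer /= (@sum_only _ (~: X)) => [|S SX]; rewrite tE.
  by rewrite /eweight big1 // mul1r setCK eqxx eq_sym.
case: eqP => [XS|_]; last by rewrite mulr0.
by move: SX; rewrite XS setCK eqxx.
Qed.

(** The empty vertices determine the set of added hedges: those at the boundary
    vertices outside [X] and [Y].  These in turn cover the boundary of [A]. *)
Lemma transfer_cap (V : finType) (A : strip V) X Y :
  transfer (cap A) X Y = transfer A (~: X) (~: Y).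
Proof.
rewrite /transfer /= sum_over_sum_set; apply: eq_bigr => S _.
pose Q0 : {set bool * V} := [set p | p.2 \notin if p.1 then Y else X].
have hit b Z (v : bool * V) :
    hits (W := (A + bool * V)%type) (fun v => inr (b, v)) Z (inr v) =
    (v.1 == b) && (v.2 \in Z) :> nat.
  case: v => b' v; rewrite /hits.
  under eq_bigr => w _ do rewrite [inr _ == _]xpair_eqE.
  case: eqP => [_|_]; last by rewrite big1.
  by rewrite -(@hits_inj _ _ (fun x => x) Z).
have hitl b Z (v : A) :
    hits (W := (A + bool * V)%type) (fun v => inr (b, v)) Z (inl v) = 0%N.
  by rewrite /hits big1.
have degr Q p : degree (G := cap A) (sum_set S Q) (inr p) = (p \in Q).
  rewrite /degree big_sum_set /= big1 // add0n -(@hits_inj _ _ (fun x => x) Q) //.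
  by apply: eq_bigr => q _; case: q => b v; rewrite /incident /= orbF.
rewrite (@sum_only _ Q0) => [|Q].
  rewrite /eweight big_sum_set /= [X in _ * X * _]big1 // mulr1 big_sumType /=.
  rewrite [X in _ * (_ * X)]big1 => [|[b v] _]; last first.
    rewrite degr !hit inE vfactor_empty /=.
    by case: b => /=; case: (_ \in _).
  rewrite mulr1; congr (_ * _); apply: eq_bigr => v _; congr vfactor.
  rewrite !hitl !addn0 /degree big_sum_set /= -addnA; congr (_ + _)%N.
  transitivity (\sum_(b : bool) \sum_(w in if b then ~: Y else ~: X)
                  (v == if b then rbound A w else lbound A w))%N.
    rewrite pair_big_dep; apply: eq_big => -[b w] //.
    by rewrite !inE /=; case: b; rewrite inE.
  by rewrite big_bool addnC.
rewrite big_sumType /= => QQ0.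
have [p pQ] : exists p, (p \in Q) != (p \in Q0).
  apply/existsP; apply: contraR QQ0 => /existsPn H; apply/eqP/setP => p.
  by apply/eqP; rewrite -[_ == _]negbK H.
rewrite [X in _ * (_ * X)](bigD1 p) //= degr !hit vfactor_empty.
suff /negPf-> : ((p \in Q) + ((p.1 == false) && (p.2 \in X)) +
    ((p.1 == true) && (p.2 \in Y)) != 1)%N by rewrite mul0r !mulr0.
move: pQ; rewrite inE; case: p => -[] v /=; do 2 case: (_ \in _) => //=.
Qed.

(** * Blocks of columns as iterated adjunctions *)

Lemma transfer_iso (V : finType) (A B : strip V) (f : A -> B)
    (g : edge A -> edge B) X Y :
  bijective f -> bijective g ->
  (forall e, ends (g e) = (f (ends e).1, f (ends e).2)) ->
  (forall v, vkind (f v) = vkind v) -> (forall e, ekind (g e) = ekind e) ->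
  (forall v, f (lbound A v) = lbound B v) ->
  (forall v, f (rbound A v) = rbound B v) ->
  transfer A X Y = transfer B X Y.
Proof.
move=> fB gB gE fk gk fl fr.
have [fI gI] := (bij_inj fB, bij_inj gB).
rewrite /transfer [RHS](reindex (fun S : {set edge A} => g @: S)) /=; last first.
  have [h gh hg] := gB.
  exists (fun S : {set edge B} => h @: S) => S _; rewrite -imset_comp.
    by rewrite (eq_imset _ gh) imset_id.
  by rewrite (eq_imset _ hg) imset_id.
apply: eq_bigr => S _; rewrite /eweight big_imset /=; last by move=> ? ? _ _ /gI.
congr (_ * _); first by apply: eq_bigr => e _; rewrite gk.
rewrite [RHS](reindex f) /=; last exact: onW_bij.
apply: eq_bigr => v _; rewrite fk; congr vfactor; congr (_ + _ + _)%N.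
- rewrite /degree big_imset /=; last by move=> ? ? _ _ /gI.
  by apply: eq_bigr => e _; rewrite /incident gE /= !(inj_eq fI).
- by apply: eq_bigr => w _; rewrite -fl (inj_eq fI).
- by apply: eq_bigr => w _; rewrite -fr (inj_eq fI).
Qed.

Lemma inj_surj_bij (T U : finType) (f : T -> U) :
  injective f -> (forall y, exists x, f x = y) -> bijective f.
Proof.
move=> fI fS; apply: inj_card_bij => //; rewrite -(card_codom fI).
by apply/subset_leq_card/subsetP => y _; have [x <-] := fS y; apply: codom_f.
Qed.

(** One column, which is both its own left and its own right boundary. *)
Definition single (H : sgraph) : strip H := @Strip H H id id.

Lemma transfer_pos0 (H : sgraph) X Y :
  transfer (pos_strip H 0) X Y = transfer (single H) X Y.
Proof.
symmetry; apply: (@transfer_iso _ (single H) (pos_strip H 0)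
  (fun v => (ord0, v)) (fun e => inl (ord0, e))) => //.
- by apply: inj_surj_bij => [v w [] //|[i v]]; exists v; rewrite (ord1 i).
- apply: inj_surj_bij => [v w [] //|[[i e]|[[[i j] ij] v]]].
    by exists e; rewrite (ord1 i).
  by exfalso; move: ij; rewrite (ord1 i) (ord1 j).
- by move=> v /=; rewrite (ord1 ord_max) (ord1 ord0).
Qed.

Section Append.
Variables (H : sgraph) (n : nat).

Definition widen (i : 'I_n.+1) : 'I_n.+2 := widen_ord (leqnSn n.+1) i.

Definition widen_edge (s : edge (path_graph n.+1)) : edge (path_graph n.+2) :=
  exist _ (widen (val s).1, widen (val s).2) (valP s).

Definition last_edge : edge (path_graph n.+2) :=
  exist _ (widen ord_max, ord_max) (eqxx n.+1).

Definition append_vertex (x : adjoin (pos_strip H n) (single H)) :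
    pos_strip H n.+1 :=
  match x with inl (i, v) => (widen i, v) | inr v => (ord_max, v) end.

Definition append_edge (x : edge (adjoin (pos_strip H n) (single H))) :
    edge (pos_strip H n.+1) :=
  match x with
  | inl (inl (inl (i, e))) => inl (widen i, e)
  | inl (inl (inr (s, v))) => inr (widen_edge s, v)
  | inl (inr e) => inl (ord_max, e)
  | inr v => inr (last_edge, v)
  end.

Lemma ord_neq_bound m (i : 'I_m) : i = m :> nat -> False.
Proof. by move=> im; have := ltn_ord i; rewrite im ltnn. Qed.

Lemma widenP (j : 'I_n.+2) : (exists i, widen i = j) \/ j = ord_max.
Proof.
have := ltn_ord j; rewrite ltnS leq_eqVlt => /orP[/eqP jn|jn]; [right|left].
  exact: val_inj.
by exists (Ordinal jn); apply: val_inj.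
Qed.

Lemma append_vertex_bij : bijective append_vertex.
Proof.
apply: inj_surj_bij => [[[i v]|v] [[j w]|w]|[j v]] /=.
- by case=> /val_inj -> ->.
- by case=> /ord_neq_bound.
- by case=> /esym/ord_neq_bound.
- by case=> ->.
- have [[i <-]|->] := widenP j; first by exists (inl (i, v)).
  by exists (inr v).
Qed.

Lemma append_edge_bij : bijective append_edge.
Proof.
apply: inj_surj_bij =>
  [[[[[i e]|[s v]]|e]|v] [[[[j f]|[t w]]|f]|w]|[[j e]|[s v]]] //=.
- by case=> /val_inj -> ->.
- by case=> /ord_neq_bound.
- case=> /val_inj st1 /val_inj st2 ->; congr (inl (inl (inr (_, _)))).
  apply: val_inj; case: s st1 st2 => -[? ?] ?; case: t => -[? ?] ? /=.
  by move=> -> ->.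
- by case=> _ /ord_neq_bound.
- by case=> /esym/ord_neq_bound.
- by case=> ->.
- by case=> _ /esym/ord_neq_bound.
- by case=> ->.
- have [[i <-]|->] := widenP j; first by exists (inl (inl (inl (i, e)))).
  by exists (inl (inr e)).
- case: s => -[i j] ij; have i_lt : (i < n.+1)%N.
    by have := ltn_ord j; rewrite -(eqP ij) ltnS.
  have [i' def_i] : exists i', widen i' = i.
    by exists (Ordinal i_lt); apply: val_inj.
  have [[j' def_j]|def_j] := widenP j; subst i j.
    exists (inl (inl (inr (exist _ (i', j') ij, v)))).
    by congr (inr (_, _)); apply: val_inj.
  exists (inr v); congr (inr (_, _)); apply: val_inj => /=; congr (_, _).
  by apply: val_inj; move/eqP: ij => -[].
Qed.

Lemma transfer_append X Y :
  transfer (pos_strip H n.+1) X Y =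
  transfer (adjoin (pos_strip H n) (single H)) X Y.
Proof.
symmetry; apply: (@transfer_iso _ (adjoin (pos_strip H n) (single H))
  (pos_strip H n.+1) append_vertex append_edge).
- exact: append_vertex_bij.
- exact: append_edge_bij.
- by move=> [[[[i e]|[s v]]|e]|v].
- by move=> [[i v]|v].
- by move=> [[[[i e]|[s v]]|e]|v].
- by move=> v /=; congr (_, _); apply: val_inj.
- by [].
Qed.

End Append.

(** * The plain and the conjugate column cancel *)

Lemma sum_sign_subset (I : finType) (D : {set I}) :
  \sum_(S : {set I} | S \subset D) (-1) ^+ #|S| = (D == set0)%:R :> int.
Proof.
transitivity (\prod_i (- (i \in D)%:R + 1 : int)).
  rewrite bigA_distr big_mkcond; apply: eq_bigr => S _ /=.
  rewrite -big_mkcond /=; case: ifPn => [/subsetP SD|/subsetPn[i iS /negPf iD]].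
    rewrite -prodr_const; apply: eq_bigr => i /SD iD.
    by rewrite iD.
  by rewrite (bigD1 i) //= iD oppr0 mul0r.
have [->|[i iD]] := set_0Vmem D.
  by rewrite eqxx big1 // => i _; rewrite inE oppr0 add0r.
rewrite (bigD1 i) //= iD addNr mul0r; case: eqP => // D0.
by rewrite D0 inE in iD.
Qed.

Lemma degree_setU (G : graph) (S T : {set edge G}) (v : G) :
  [disjoint S & T] -> degree (S :|: T) v = (degree S v + degree T v)%N.
Proof.
move=> dST; rewrite /degree -bigU //=.
by apply: eq_bigl => e; rewrite inE.
Qed.

(** If [S] and [T] share an edge, its ends have degree at least 2 and the term
    vanishes.  Otherwise the product depends only on [D = S :|: T], and the signs
    summed over the ways to choose [T] inside a nonempty [D] cancel. *)
Lemma signed_edge_cancel (G : graph) (g : G -> nat -> int) :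
  (forall v d, (1 < d)%N -> g v d = 0) ->
  \sum_(S : {set edge G}) \sum_(T : {set edge G})
    (-1) ^+ #|T| * \prod_v g v (degree S v + degree T v)%N = \prod_v g v 0%N.
Proof.
move=> g0; pose P (D : {set edge G}) := \prod_v g v (degree D v).
transitivity (\sum_(D : {set edge G}) \sum_(T : {set edge G} | T \subset D)
                (-1) ^+ #|T| * P D).
  rewrite exchange_big [RHS](exchange_big_dep predT) //=; apply: eq_bigr => T _.
  (* For fixed T, the sets S disjoint from T correspond to the D containing T. *)
  rewrite [RHS](reindex_onto (fun S => S :|: T) (fun D => D :\: T)) /=;
    last first.
    by move=> D TD; rewrite setUC -{1}(setIidPr TD) setID.
  rewrite [LHS](bigID (fun S : {set edge G} => [disjoint S & T])) /=.
  rewrite [X in _ + X]big1 ?addr0.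
    apply: eq_big => [S|S dST].
      rewrite subsetUr setDUl setDv setU0 /=.
      exact/setDidPl/eqP.
    by congr (_ * _); apply: eq_bigr => v _; rewrite degree_setU.
  move=> S; rewrite -setI_eq0 => /set0Pn[e]; rewrite inE => /andP[eS eT].
  rewrite (bigD1 (ends e).1) //= g0 ?mul0r ?mulr0 //.
  rewrite /degree (bigD1 e) //= [X in (_ < _ + X)%N](bigD1 e) //=.
  by rewrite /incident eqxx /= addnACA leq_addr.
under [LHS]eq_bigr => D _ do rewrite -mulr_suml sum_sign_subset.
rewrite (sum_only (i0 := set0)) => [|D /negPf->]; last by rewrite mul0r.
rewrite eqxx mul1r; apply: eq_bigr => v _; congr g.
by rewrite /degree big_set0.
Qed.

(** The total contribution of a vertex [v], summed over the membership of [v] in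
    the intermediate set [Z], when [x] and [y] tell whether [v] is in [X] and in
    [Y], and [d] is the total degree of [v] in the two columns. *)
Definition site (x y : bool) (d : nat) : int :=
  if x == y then (d == 0%N)%:R else (y && (d == 1%N))%:R.

(** The point is that the sum depends only on [a + b]: a vertex does not see
    which of the two columns its edge comes from.  The case [a = b = 0] with [x]
    false and [y] true is where an uncovered plain vertex cancels against an
    uncovered anti-vertex. *)
Lemma site_sum (x y : bool) (a b : nat) :
  vfactor PlainVertex (a + x + true) * vfactor AntiVertex (b + false + ~~ y)
  + vfactor PlainVertex (a + x + false) * vfactor AntiVertex (b + true + ~~ y)
  = site x y (a + b).
Proof.
by case: x; case: y; case: a => [|[|a]]; case: b => [|[|b]];
   rewrite ?addn0 ?addn1 ?addnS ?addSn.
Qed.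

Lemma transfer_single (H : sgraph) X Y :
  transfer (single H) X Y = \sum_(S : {set edge H}) eweight S * \prod_(v : H)
    vfactor (vkind v) (degree S v + (v \in X) + (v \in Y)).
Proof.
apply: eq_bigr => S _; congr (_ * _); apply: eq_bigr => v _.
by rewrite (@hits_inj _ _ id) // (@hits_inj _ _ id).
Qed.

(** The factors at different vertices choose their membership in [Z]
    independently, so the sum over [Z] of the products is the product of the
    local sums [site]; these depend on the degrees only through their total, so
    the edges then cancel by [signed_edge_cancel]. *)
Lemma transfer_plain_conjugate (G : graph) (X Y : {set G}) :
  \sum_(Z : {set G}) transfer (single (plain G)) X Z *
    transfer (single (conjugate (plain G))) (~: Z) (~: Y) = (X == Y)%:R.
Proof.
under eq_bigr => Z _ do rewrite !transfer_single big_distrlr /=.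
rewrite exchange_big /=; under eq_bigr => S _ do rewrite exchange_big /=.
transitivity (\sum_(S : {set edge G}) \sum_(T : {set edge G})
   (-1) ^+ #|T| *
     \prod_(v : G) site (v \in X) (v \in Y) (degree S v + degree T v)).
  apply: eq_bigr => S _; apply: eq_bigr => T _.
  under [in RHS]eq_bigr => v _ do rewrite -site_sum.
  rewrite bigA_distr mulr_sumr; apply: eq_bigr => Z _.
  rewrite /eweight [X in X * _ * _]big1 // mul1r prodr_const.
  rewrite mulrCA -big_split; congr (_ * _); apply: eq_bigr => v _ /=.
  by rewrite !inE; case: (v \in Z).
rewrite (signed_edge_cancel (g := fun v => site (v \in X) (v \in Y)));
  last move=> v [|[|d]] //.
  transitivity (\prod_v ((v \in X) == (v \in Y))%:R : int).
    by apply: eq_bigr => v _; rewrite /site andbF; case: ifP.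
  rewrite prod_bool; congr (_%:R); congr nat_of_bool.
  apply/forallP/eqP => [XY|-> //]; apply/setP => v; exact/eqP.
by rewrite /site; case: ifP; rewrite ?andbF.
Qed.

(** * Transfer matrices *)

Section SetMatrix.
Variable V : finType.

(** Square matrices carry a ring structure with inverses only when their size is
    manifestly a successor, whence the predecessor in the size. *)
Lemma card_sets_predK : #|{set V}|.-1.+1 = #|{set V}|.
Proof. by rewrite prednK //; apply/card_gt0P; exists set0. Qed.

Definition set_at (i : 'I_#|{set V}|.-1.+1) : {set V} :=
  enum_val (cast_ord card_sets_predK i).

Lemma set_at_bij : bijective set_at.
Proof.
exists (fun X => cast_ord (esym card_sets_predK) (enum_rank X)) => x.
  by rewrite /set_at enum_valK cast_ordK.
by rewrite /set_at cast_ordKV enum_rankK.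
Qed.

Definition set_matrix (f : {set V} -> {set V} -> int) :
    'M[int]_(#|{set V}|.-1.+1) :=
  \matrix_(i, j) f (set_at i) (set_at j).

Lemma set_matrix_inj f g : set_matrix f = set_matrix g -> f =2 g.
Proof.
have [h _ hK] := set_at_bij.
by move=> /matrixP fg X Y; have := fg (h X) (h Y); rewrite !mxE !hK.
Qed.

Lemma eq_set_matrix f g : f =2 g -> set_matrix f = set_matrix g.
Proof. by move=> fg; apply/matrixP => i j; rewrite !mxE fg. Qed.

Lemma set_matrixM f g :
  set_matrix f * set_matrix g = set_matrix (fun X Y => \sum_Z f X Z * g Z Y).
Proof.
apply/matrixP => i j; rewrite !mxE (reindex set_at) /=;
  last exact: onW_bij set_at_bij.
by apply: eq_bigr => k _; rewrite !mxE.
Qed.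

Lemma set_matrix1 : set_matrix (fun X Y => (X == Y)%:R) = 1.
Proof. by apply/matrixP => i j; rewrite !mxE (bij_eq set_at_bij). Qed.

Definition transfer_matrix (A : strip V) := set_matrix (transfer A).

Lemma transfer_matrix_adjoin A B :
  transfer_matrix (adjoin A B) = transfer_matrix A * transfer_matrix B.
Proof. by rewrite set_matrixM; apply/eq_set_matrix/transfer_adjoin. Qed.

Lemma transfer_matrix_zero : transfer_matrix (zero_strip V) = 1.
Proof. by rewrite -set_matrix1; apply/eq_set_matrix/transfer_zero. Qed.

Lemma transfer_matrix_adjoin_seq A Bs :
  transfer_matrix (adjoin_seq A Bs) =
  transfer_matrix A * \prod_(B <- Bs) transfer_matrix B.
Proof.
elim: Bs A => [|B Bs IH] A /=; first by rewrite big_nil mulr1.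
by rewrite IH transfer_matrix_adjoin big_cons mulrA.
Qed.

Lemma M_transfer_matrix A B :
  transfer_matrix A = transfer_matrix B -> M A = M B.
Proof. by move=> /set_matrix_inj AB; rewrite !M_transfer AB. Qed.

Definition complement_matrix := set_matrix (fun X Y => (X == ~: Y)%:R).

Lemma complement_matrixK : complement_matrix * complement_matrix = 1.
Proof.
rewrite set_matrixM -set_matrix1; apply: eq_set_matrix => X Y.
rewrite (sum_only (i0 := ~: X)) => [|Z ZX].
  by rewrite setCK eqxx mul1r (inj_eq (@setC_inj V)).
by case: eqP => [XZ|_]; rewrite ?mul0r //; rewrite XZ setCK eqxx in ZX.
Qed.

Lemma transfer_matrix_cap A :
  transfer_matrix (cap A) =
  complement_matrix * transfer_matrix A * complement_matrix.
Proof.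
rewrite !set_matrixM; apply: eq_set_matrix => X Y; rewrite transfer_cap.
rewrite (sum_only (i0 := ~: Y)) => [|Z /negPf ZY]; last by rewrite ZY mulr0.
rewrite eqxx mulr1 (sum_only (i0 := ~: X)) => [|Z ZX].
  by rewrite setCK eqxx mul1r.
by case: eqP => [XZ|_]; rewrite ?mul0r //; rewrite XZ setCK eqxx in ZX.
Qed.

End SetMatrix.

Lemma transfer_matrix_pos (H : sgraph) n :
  transfer_matrix (pos_strip H n) = transfer_matrix (single H) ^+ n.+1.
Proof.
elim: n => [|n IH]; first exact/eq_set_matrix/transfer_pos0.
rewrite exprSr -IH -transfer_matrix_adjoin.
exact/eq_set_matrix/transfer_append.
Qed.

Definition column_matrix (G : graph) := transfer_matrix (single (plain G)).

Lemma column_matrix_inverse (G : graph) :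
  column_matrix G * (complement_matrix G *
    transfer_matrix (single (conjugate (plain G))) * complement_matrix G) = 1.
Proof.
rewrite -transfer_matrix_cap set_matrixM -set_matrix1.
apply: eq_set_matrix => X Y; rewrite -transfer_plain_conjugate.
by apply: eq_bigr => Z _; rewrite transfer_cap.
Qed.

(** For a negative power, [J * J = 1] lets the inner complementations cancel in
    [(J T' J) ^ n]. *)
Lemma transfer_matrix_times_path (G : graph) (n : int) :
  transfer_matrix (times_path G n) = column_matrix G ^ n.
Proof.
case: n => [[|n]|n].
- exact: transfer_matrix_zero.
- by rewrite -exprnP; exact: (transfer_matrix_pos (plain G)).
rewrite /= NegzE -exprnN transfer_matrix_cap.
set J := complement_matrix _.
pose B := transfer_matrix (single (conjugate (plain G)) : strip G).
rewrite (transfer_matrix_pos (conjugate (plain G)) n : _ = B ^+ n.+1).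
have JJ : J * J = 1 by exact: complement_matrixK.
have -> : J * B ^+ n.+1 * J = (J * B * J) ^+ n.+1.
  elim: n => [//|n IH]; rewrite exprS [RHS]exprS -IH.
  by rewrite !mulrA -[_ * J * J]mulrA JJ mulr1.
have uT := column_matrix_inverse G.
suff -> : J * B * J = (column_matrix G)^-1 by rewrite exprVn.
have [uG _] := mulmx1_unit uT.
by rewrite -[LHS](mulKr uG) uT mulr1.
Qed.

Lemma column_matrix_unit (G : graph) : column_matrix G \is a GRing.unit.
Proof. by have [] := mulmx1_unit (column_matrix_inverse G). Qed.

Lemma M_adjoin_times_path (G : graph) (n1 : int) (ns : seq int) :
  M (adjoin_seq (times_path G n1) [seq times_path G n | n <- ns]) =
  M (times_path G (n1 + \sum_(n <- ns) n)).
Proof.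
apply: M_transfer_matrix.
rewrite transfer_matrix_adjoin_seq big_map !transfer_matrix_times_path.
rewrite exprzDr ?column_matrix_unit //; congr (_ * _).
elim: ns => [|n ns IH]; first by rewrite !big_nil.
by rewrite !big_cons exprzDr ?column_matrix_unit // IH transfer_matrix_times_path.
Qed.

Theorem theorem1 :
  (forall (G : graph) (n1 : int) (ns : seq int),
     M (adjoin_seq (times_path G n1) [seq times_path G n | n <- ns]) =
     M (times_path G (n1 + \sum_(n <- ns) n))) /\
  (forall (m : nat) (n1 : int) (ns : seq int), (1 <= m)%N ->
     M (adjoin_seq (grid m n1) [seq grid m n | n <- ns]) =
     M (grid m (n1 + \sum_(n <- ns) n))).
Proof.
split; first exact: M_adjoin_times_path.
by move=> m n1 ns _; apply: M_adjoin_times_path.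
Qed.
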